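(* Let $R$ be an integral domain, let $(G,A)$ be an edge-labeled connected graph with $n$ vertices and edge labels in $R$, and let $R_G$ be its module of generalized splines. Suppose there exists some $Q\in R$ such that $Q\mid\det[C_1,\dots,C_n]$ for any $\{C_1,\dots,C_n\}\subset R_G$. Then if $B=\{B_1,\dots,B_n\}$ is any subset of $R_G$ for which $\det[B_1,\dots,B_n]=Q$, then $B$ is a basis for $R_G$.
   Context: For a connected graph $G$ with vertices $v_1,\dots,v_n$, edges $e_1,\dots,e_m$ and edge labels $A=\{a_1,\dots,a_m\}\subseteq R$ ($a_k$ being the label of $e_k$), a generalized spline on $G$ over $R$ is a tuple $(f_1,\dots,f_n)\in R^n$ such that whenever $v_i$ and $v_j$ are joined by the edge $e_k$, $f_i-f_j\in\langle a_k\rangle$, the ideal of $R$ generated by $a_k$. The set $R_G$ of all generalized splines is an $R$-submodule of $R^n$, and ''basis'' means basis as an $R$-module. Subsets $\{C_1,\dots,C_n\}$ are taken to be ordered, and $[C_1,\dots,C_n]$ denotes the $n\times n$ matrix whose columns are $C_1,\dots,C_n$.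
   Formalization: It is additionally assumed that Q is nonzero or that all edge labels are nonzero; otherwise the claim fails, e.g. for one edge labeled 0, where Q = 0 and B = {(1,1),(0,0)} has determinant Q but is not a basis. *)

(* Defs.v *)
From HB Require Import structures.
From mathcomp Require Import all_boot all_order all_algebra.

Set Implicit Arguments.
Unset Strict Implicit.
Unset Printing Implicit Defensive.

Import GRing.Theory.
Local Open Scope ring_scope.

(* An edge is a two-element set of vertices. Edges are indexed, so that parallel
   edges (with possibly different labels) are allowed; loops are not. *)
Record edge_labeled_graph (R : Type) (n m : nat) := EdgeLabeledGraph {
  ends : 'I_m -> {set 'I_n};
  card_ends : forall k, #|ends k| = 2;
  label : 'I_m -> R
}.

Definition adjacent (R : Type) n m (G : edge_labeled_graph R n m) : rel 'I_n :=
  fun i j => [exists k, ends G k == [set i; j]].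

(* The empty graph is not connected. *)
Definition connected_graph (R : Type) n m (G : edge_labeled_graph R n m) : Prop :=
  (0 < n)%N /\ forall i j, connect (adjacent G) i j.

(* Membership in an ideal of an abstract ring is not decidable, hence Prop. *)
Definition principal_ideal (R : idomainType) (a : R) : R -> Prop :=
  fun x => exists r, x = r * a.

Definition divides (R : idomainType) (d x : R) : Prop := exists r, x = r * d.

Definition spline (R : idomainType) n m (G : edge_labeled_graph R n m) :
    'cV[R]_n -> Prop :=
  fun f => forall k i j, ends G k = [set i; j] ->
    principal_ideal (label G k) (f i 0 - f j 0).

Definition submodule (R : nzRingType) (V : lmodType R) (S : V -> Prop) : Prop :=
  S 0 /\ forall a u v, S u -> S v -> S (a *: u + v).

Lemma spline_submodule (R : idomainType) n m (G : edge_labeled_graph R n m) :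
  submodule (spline G).
Proof.
split=> [k i j _|a f g Sf Sg k i j Ek]; first by exists 0; rewrite !mxE subrr mul0r.
have [[r Er] [s Es]] := (Sf k i j Ek, Sg k i j Ek).
exists (a * r + s); rewrite !mxE mulrDl -mulrA -Er -Es mulrBr.
by rewrite opprD addrACA.
Qed.

Definition is_basis (R : nzRingType) (V : lmodType R) (S : V -> Prop) n
    (B : 'I_n -> V) : Prop :=
  [/\ forall i, S (B i),
      forall v, S v -> exists c : 'I_n -> R, v = \sum_i c i *: B i
    & forall c : 'I_n -> R, \sum_i c i *: B i = 0 -> forall i, c i = 0].

Definition mx_of_cols (R : Type) n (C : 'I_n -> 'cV[R]_n) : 'M[R]_n :=
  \matrix_(i, j) C j i 0.

(* Main.v *)
Require Import Defs.
From HB Require Import structures.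
From mathcomp Require Import all_boot all_order all_algebra.

Set Implicit Arguments.
Unset Strict Implicit.
Unset Printing Implicit Defensive.

Import GRing.Theory.
Local Open Scope ring_scope.

(** Let [M] be the matrix with columns [B], so that [\det M = Q]. When [Q] is
    nonzero, the columns of [M] are independent because
    [\adj M *m M = Q%:M] and [R] has no zero divisors. They generate by Cramer's
    rule: for a spline [v], the vector [\adj M *m v] solves [M *m x = Q *: v],
    and its [i]-th entry is the determinant of [M] with column [i] replaced by
    [v]. The columns of that matrix are again splines, so [Q] divides every
    entry of [x], and cancelling [Q] expresses [v] as a combination of [B]
    (lemma [basis_of_minimal_det]).

    It remains to see that [Q] is nonzero when all labels are. The product of
    the labels times any vector is a spline, so the scalar matrix of this
    product has splines as columns. Its determinant is nonzero, and [Q] divides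
    it (lemma [exists_splines_det_neq0]). *)

Lemma mx_of_cols_mul (R : comNzRingType) n (B : 'I_n -> 'cV[R]_n)
    (x : 'cV[R]_n) :
  mx_of_cols B *m x = \sum_i x i 0 *: B i.
Proof.
apply/matrixP=> i j; rewrite !mxE summxE; apply: eq_bigr => k _.
by rewrite !mxE ord1 mulrC.
Qed.

(** Cramer's rule in adjugate form: expanding the determinant along the replaced
    column [i] meets the same minors as [\adj] of the original matrix, since
    these delete that column. *)
Lemma adj_mul_col (R : comNzRingType) n (B : 'I_n -> 'cV[R]_n)
    (v : 'cV[R]_n) i :
  (\adj (mx_of_cols B) *m v) i 0 =
  \det (mx_of_cols (fun j => if j == i then v else B j)).
Proof.
rewrite (expand_det_col _ i) mxE; apply: eq_bigr => k _.
rewrite !mxE eqxx mulrC; congr (_ * (_ * \det _)).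
by apply/matrixP=> a b; rewrite !mxE eq_sym (negPf (neq_lift _ _)).
Qed.

(** The divisibility hypothesis is applied to the families obtained from [B] by
    replacing one vector with an element of [S]: by [adj_mul_col] their
    determinants are the numerators in Cramer's rule, so the rational solution
    of the linear system has all its coordinates in [R]. *)
Lemma basis_of_minimal_det (R : idomainType) n (S : 'cV[R]_n -> Prop)
    (B : 'I_n -> 'cV[R]_n) :
  \det (mx_of_cols B) != 0 ->
  (forall C : 'I_n -> 'cV[R]_n, (forall i, S (C i)) ->
     divides (\det (mx_of_cols B)) (\det (mx_of_cols C))) ->
  (forall i, S (B i)) ->
  is_basis S B.
Proof.
set M := mx_of_cols B => detM_neq0 detM_dvd SB.
have sumE c : \sum_i c i *: B i = M *m \col_i c i.
  by rewrite mx_of_cols_mul; apply: eq_bigr => i _; rewrite mxE.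
split=> // [v Sv | c].
- have /fin_all_exists[c cE] i :
      exists r, (\adj M *m v) i 0 = r * \det M.
    rewrite adj_mul_col; apply: detM_dvd => j.
    by case: ifP.
  have detM_v : \det M *: v = \det M *: (M *m \col_i c i).
    rewrite scalemxAr -[LHS]mul_scalar_mx -mul_mx_adj -mulmxA; congr (M *m _).
    by apply/colP=> i; rewrite cE !mxE mulrC.
  exists c; rewrite sumE; apply/colP=> i; apply: (mulfI detM_neq0).
  by move/colP/(_ i): detM_v; rewrite mxE => ->; rewrite mxE.
- rewrite sumE => Mc0 i; apply/(mulfI detM_neq0); rewrite mulr0.
  have /colP/(_ i) : \det M *: (\col_i c i) = 0.
    by rewrite -mul_scalar_mx -mul_adj_mx -mulmxA Mc0 mulmx0.
  by rewrite !mxE.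
Qed.

Lemma prod_labels_spline (R : idomainType) n m
    (G : edge_labeled_graph R n m) (v : 'cV[R]_n) :
  spline G ((\prod_k label G k) *: v).
Proof.
move=> k i j _; rewrite !mxE -mulrBr (bigD1 k) //= -mulrA mulrC.
by exists ((\prod_(l | l != k) label G l) * (v i 0 - v j 0)).
Qed.

(** Nonzero labels make the splines a module of full rank [n]. *)
Lemma exists_splines_det_neq0 (R : idomainType) n m
    (G : edge_labeled_graph R n m) :
  (forall k, label G k != 0) ->
  exists2 C : 'I_n -> 'cV[R]_n,
    forall i, spline G (C i) & \det (mx_of_cols C) != 0.
Proof.
move=> label_neq0; set p := \prod_k label G k.
exists (fun i => p *: delta_mx i 0) => [i|].
  exact: prod_labels_spline.
have -> : mx_of_cols (fun i => p *: delta_mx i 0) = p%:M :> 'M[R]_n.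
  by apply/matrixP=> i j; rewrite !mxE eqxx andbT mulr_natr.
by rewrite det_scalar expf_neq0 //; apply/prodf_neq0.
Qed.

(* For Q = 0 the claim fails when some label is 0: on a single edge labeled 0
   the splines are the constant pairs, every determinant is 0, and no pair of
   splines is a basis. The hypothesis nondeg excludes only this situation. *)
Theorem theorem4p4 (R : idomainType) (n m : nat) (G : edge_labeled_graph R n m)
    (connG : connected_graph G) (Q : R)
    (nondeg : Q != 0 \/ forall k, label G k != 0)
    (dvdQ : forall C : 'I_n -> 'cV[R]_n,
       (forall i, spline G (C i)) -> divides Q (\det (mx_of_cols C)))
    (B : 'I_n -> 'cV[R]_n) (splineB : forall i, spline G (B i))
    (detB : \det (mx_of_cols B) = Q) :
  is_basis (spline G) B.
Proof.
have Q_neq0 : Q != 0.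
  case: nondeg => // /exists_splines_det_neq0[C splineC].
  have [r ->] := dvdQ C splineC.
  by apply: contraNneq => ->; rewrite mulr0.
by apply: basis_of_minimal_det; rewrite ?detB.
Qed.
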